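(* Let $X$ be a partial quandle with a binary relation $\mathcal R$, and let $f\colon Arcs(D)\to X$ be a coloring of type II of an oriented link diagram $D$ with a binary relation $R$ on the set of its components $\{C_1,\ldots,C_s\}$. For $i\in\{1,\ldots,s\}$ let $Gcr_i$ be the set of all good crossings in which the under-arcs belong to the component $C_i$. To each positive good crossing assign the pair $(x,y)\in X\times X$, where $y$ is the color of the over-arc and $x$ is the color of the under-arc away from which the normal of the over-arc points; to each negative good crossing assign $-(x,y)$, with $x,y$ determined in the same way. Let $z_i$ be the sum of these signed pairs over all crossings in $Gcr_i$. Then each $z_i$ is a cycle in $(C^{PQ}_2(X),\partial_2)$, and it represents an element of $H^{PQ}_2(X)$ that is invariant under all the Reidemeister moves permitted by the relation $R$.
   Context: For a relation $\mathcal R$ on $X$, $a\sim_{\mathcal R}b$ means that for all $c\in X$: $a\,\mathcal R\,c$ iff $b\,\mathcal R\,c$, and $c\,\mathcal R\,a$ iff $c\,\mathcal R\,b$. A partial quandle with a binary relation is a set $X$ with two partial operations $*$, $\bar{*}$ and a relation $\mathcal R\subseteq X\times X$ such that: (PQ1) if $x\,\mathcal R\,y$, then $x*y$ and $x\,\bar{*}\,y$ are defined; (PQ2) if $x\,\mathcal R\,y$, then $x*y\sim_{\mathcal R}x$ and $x\,\bar{*}\,y\sim_{\mathcal R}x$; (PQ3) if $x\,\mathcal R\,x$, then $x*x=x=x\,\bar{*}\,x$; (PQ4) if $x\,\mathcal R\,y$, then $(x*y)\,\bar{*}\,y=x=(x\,\bar{*}\,y)*y$; (PQ5) if $x\,\mathcal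 R\,y$, $x\,\mathcal R\,z$ and $y\,\mathcal R\,z$, then $(x*y)*z=(x*z)*(y*z)$. Homology. For $n\ge1$, $C^{PR}_n(X)$ is the free abelian group generated by the $n$-tuples $(x_1,\ldots,x_n)\in X^n$ of defect $0$, i.e. with $x_i\,\mathcal R\,x_j$ for all $i<j$; $C^{PR}_0(X)=\mathbb Z$. The boundary is $\partial_1=0$ and, for $n\ge2$, $\partial_n(x_1,\ldots,x_n)=\sum_{i=1}^n(-1)^i\big((x_1,\ldots,x_{i-1},x_{i+1},\ldots,x_n)-(x_1*x_i,\ldots,x_{i-1}*x_i,x_{i+1},\ldots,x_n)\big)$. $C^{PD}_n(X)$ is the subgroup generated by the defect-$0$ $n$-tuples with $x_i=x_{i+1}$ for some $i$ if $n\ge2$, and $0$ otherwise; it is a subcomplex. $C^{PQ}_n(X)=C^{PR}_n(X)/C^{PD}_n(X)$, and $H^{PQ}_*(X)$ is the homology of $(C^{PQ}_*(X),\partial_* )$. Links with relations. $D$ is an oriented link diagram with components $C_1,\ldots,C_s$, and $R$ is a binary relation on $\{C_1,\ldots,C_s\}$. The component $C_j$ can move over the component $C_i$ if and only if $C_i\,R\,C_j$. Accordingly, permitted moves (in both directions) are: a first Reidemeister move on $C_i$ if $C_i\,R\,C_i$; a second Reidemeister move in which a strand of $C_j$ is the over-strand and a strand of $C_i$ the under-strand, if $C_i\,R\,C_j$; a third Reidemeister move with the top strand from $C_k$ and the other two strands from $C_i$ and $C_j$, if $C_i\,R\,C_k$ and $C_j\,R\,C_k$. The relation $R$ induces a relation,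 also denoted $R$, on $Arcs(D)$ (the set of arcs of $D$): for arcs $a$ of $C_i$ and $b$ of $C_j$, $a\,R\,b$ iff $C_i\,R\,C_j$; likewise after each move. A crossing whose under-arcs belong to $C_i$ and whose over-arc belongs to $C_j$ is good if $C_i\,R\,C_j$, and bad otherwise. Colorings. Normals to arcs are chosen so that (tangent vector, normal vector) matches the orientation of the plane. At a crossing with over-arc $a_2$ and under-arcs $a_1,a_3$ such that the normal of $a_2$ points from $a_1$ to $a_3$, the quandle coloring rule for $f$ is $f(a_3)=f(a_1)*f(a_2)$ (equivalently $f(a_1)=f(a_3)\,\bar{*}\,f(a_2)$). A coloring of type II is a map $f\colon Arcs(D)\to X$ that is monotone ($a\,R\,b$ implies $f(a)\,\mathcal R\,f(b)$), satisfies the quandle coloring rule at every good crossing, and assigns the same color to both under-arcs at every bad crossing. Invariance: a permitted Reidemeister move from $D$ to $D'$ induces a bijection between type II colorings of $D$ and of $D'$, matching $f$ with the coloring $f'$ of $D'$ that agrees with $f$ outside the disk in which the move takes place. Invariance of the class means that the classes in $H^{PQ}_2(X)$ of $z_i$ computed from $(D,f)$ and from $(D',f')$ are equal, for each $i$. *)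

(* Defs.v *)
From HB Require Import structures.
From mathcomp Require Import freeg.
From mathcomp Require Import all_boot fingroup perm all_algebra boolp zify.

Set Implicit Arguments.
Unset Strict Implicit.
Unset Printing Implicit Defensive.

Import GRing.Theory.

Local Open Scope ring_scope.
Local Open Scope quotient_scope.

Definition rel_similar (T : Type) (r : T -> T -> Prop) (a b : T) : Prop :=
  forall c, (r a c <-> r b c) /\ (r c a <-> r c b).

(* Partial operations are option-valued, and an equation between composites
   asserts that both sides are defined. *)
Record partialQuandle := PartialQuandle {
  pq_sort :> Type;
  pq_op : pq_sort -> pq_sort -> option pq_sort;
  pq_opb : pq_sort -> pq_sort -> option pq_sort;
  pq_rel : pq_sort -> pq_sort -> Prop;
  pq1 : forall x y, pq_rel x y -> pq_op x y /\ pq_opb x y;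
  pq2 : forall x y, pq_rel x y ->
    (forall w, pq_op x y = Some w -> rel_similar pq_rel w x) /\
    (forall w, pq_opb x y = Some w -> rel_similar pq_rel w x);
  pq3 : forall x, pq_rel x x -> pq_op x x = Some x /\ pq_opb x x = Some x;
  pq4 : forall x y, pq_rel x y ->
    obind (fun w => pq_opb w y) (pq_op x y) = Some x /\
    obind (fun w => pq_op w y) (pq_opb x y) = Some x;
  pq5 : forall x y z, pq_rel x y -> pq_rel x z -> pq_rel y z ->
    exists w,
      obind (fun u => pq_op u z) (pq_op x y) = Some w /\
      obind (fun u => obind (fun v => pq_op u v) (pq_op y z)) (pq_op x z)
        = Some w
}.

(* v belongs to the smallest subgroup containing S. *)
Definition generated (V : zmodType) (S : V -> Prop) (v : V) : Prop :=
  forall H : V -> Prop,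
    H 0 -> (forall a b, H a -> H b -> H (a - b)) -> (forall a, S a -> H a) ->
    H v.

Section Homology.
Variable X : partialQuandle.

(* Used only when pq_rel x y holds, so that the default is never taken. *)
Definition star (x y : X) : X := odflt x (pq_op x y).

Lemma star_similar (x y : X) :
  pq_rel x y -> rel_similar (@pq_rel X) (star x y) x.
Proof.
move=> xy; rewrite /star; have [+ _] := pq1 xy; have [+ _] := pq2 xy.
by case: (pq_op x y) => // w /(_ w erefl).
Qed.

Lemma star_rel (x y z : X) :
  pq_rel x y -> pq_rel x z -> pq_rel y z -> pq_rel (star x z) (star y z).
Proof.
move=> xy xz yz; have [_ h] := star_similar yz (star x z).
by apply/h; have [g _] := star_similar xz y; apply/g.
Qed.

Definition defect0 n (t : n.-tuple {classic X}) : Prop :=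
  forall i j : 'I_n, (i < j)%N -> pq_rel (tnth t i) (tnth t j).

Definition dtuple n := {t : n.-tuple {classic X} | `[< defect0 t >]}.

Definition CPR n : zmodType := {freeg (dtuple n) / int}.

Definition del_tuple n (t : n.+1.-tuple {classic X}) (i : 'I_n.+1) :
    n.-tuple {classic X} :=
  [tuple tnth t (lift i j) | j < n].

Definition act_tuple n (t : n.+1.-tuple {classic X}) (i : 'I_n.+1) :
    n.-tuple {classic X} :=
  [tuple (if (j < i)%N then star (tnth t (lift i j)) (tnth t i)
          else tnth t (lift i j)) | j < n].

Lemma ltn_lift n (i : 'I_n.+1) (j k : 'I_n) :
  (j < k)%N -> (lift i j < lift i k)%N.
Proof.
move=> jk; rewrite /= /bump; case: (leqP i j) => ij.
  by rewrite (leq_trans ij (ltnW jk)).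
by rewrite add0n; case: (i <= k)%N; rewrite ?add1n ?add0n // (ltn_trans jk).
Qed.

Lemma ltn_lift_lt n (i : 'I_n.+1) (j : 'I_n) : (j < i)%N -> (lift i j < i)%N.
Proof. by move=> ji; rewrite /= /bump [(i <= j)%N]leqNgt ji. Qed.

Lemma ltn_lift_gt n (i : 'I_n.+1) (j : 'I_n) : (i <= j)%N -> (i < lift i j)%N.
Proof. by move=> ij; rewrite /= /bump ij. Qed.

Lemma del_tuple_defect0 n (t : n.+1.-tuple {classic X}) i :
  defect0 t -> defect0 (del_tuple t i).
Proof.
by move=> dt j k jk; rewrite !tnth_mktuple; apply: dt; apply: ltn_lift.
Qed.

Lemma act_tuple_defect0 n (t : n.+1.-tuple {classic X}) i :
  defect0 t -> defect0 (act_tuple t i).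
Proof.
move=> dt j k jk; rewrite !tnth_mktuple.
have tjk := dt _ _ (ltn_lift i jk).
case: (ltnP j i) => ji; last by rewrite ltnNge (leq_trans ji (ltnW jk)).
have tji := dt _ _ (ltn_lift_lt ji).
case: (ltnP k i) => ki; first exact: star_rel tjk tji (dt _ _ (ltn_lift_lt ki)).
by have [h _] := star_similar tji (tnth t (lift i k)); apply/h.
Qed.

Definition del_face n (t : dtuple n.+1) (i : 'I_n.+1) : dtuple n :=
  exist _ (del_tuple (val t) i)
    (asboolT (del_tuple_defect0 i (asboolW (valP t)))).

Definition act_face n (t : dtuple n.+1) (i : 'I_n.+1) : dtuple n :=
  exist _ (act_tuple (val t) i)
    (asboolT (act_tuple_defect0 i (asboolW (valP t)))).

(* i is counted from 0, which accounts for the exponent.  For n = 0 the two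
   faces coincide, so that the first boundary map is 0. *)
Definition bd n (c : CPR n.+1) : CPR n :=
  fglift (fun t : dtuple n.+1 =>
    \sum_(i < n.+1) (-1) ^+ i.+1 *: (<< del_face t i >> - << act_face t i >>
                                     : {freeg (dtuple n) / int})) c.

Lemma bd_is_zmod_morphism n : zmod_morphism (@bd n).
Proof. exact: lift_is_additive. Qed.

HB.instance Definition _ n :=
  GRing.isZmodMorphism.Build (CPR n.+1) (CPR n) (@bd n)
    (@bd_is_zmod_morphism n).

Definition degenerate n (t : n.-tuple {classic X}) : Prop :=
  exists i j : 'I_n, j = i.+1 :> nat /\ tnth t i = tnth t j.

Definition CPD n : {pred CPR n} := fun c =>
  `[< generated (fun v : CPR n =>
        exists2 t : dtuple n, degenerate (val t) & v = << t >>) c >].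

Lemma CPD_zmod_closed n : zmod_closed (@CPD n).
Proof.
split=> [|a b /asboolP ha /asboolP hb]; apply/asboolP => H H0 HB HS //.
exact: HB (ha _ H0 HB HS) (hb _ H0 HB HS).
Qed.

HB.instance Definition _ n :=
  GRing.isZmodClosed.Build (CPR n) (@CPD n) (@CPD_zmod_closed n).

Definition CPQ n : zmodType := Quotient.quot (@CPD n).

Definition classPQ n (c : CPR n) : CPQ n := \pi_(Quotient.quot (@CPD n)) c.


Lemma classPQ_eq n (a b : CPR n) : classPQ a = classPQ b <-> a - b \in @CPD n.
Proof. by rewrite Quotient.idealrBE /classPQ; split=> [h|/eqP]; [apply/eqP|]. Qed.

Lemma mem_CPD n (t : dtuple n) :
  degenerate (val t) -> (<< t >> : CPR n) \in @CPD n.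
Proof. by move=> dt; apply/asboolP => H _ _; apply; exists t. Qed.

Lemma consecutive_lift n (t : n.+1.-tuple {classic X}) (a b i : 'I_n.+1) :
  b = a.+1 :> nat -> i != a -> i != b ->
  exists j j' : 'I_n,
    [/\ a = lift i j, b = lift i j', j' = j.+1 :> nat & (j < i)%N = (j' < i)%N].
Proof.
move=> ab ia ib.
case: (unliftP i a) => [j ej|e]; last by rewrite e eqxx in ia.
case: (unliftP i b) => [j' ej'|e]; last by rewrite e eqxx in ib.
exists j, j'; split=> //; have := ab; rewrite {1}ej' {1}ej /= /bump; lia.
Qed.

Lemma del_face_degenerate n (t : dtuple n.+1) (a b i : 'I_n.+1) :
  b = a.+1 :> nat -> tnth (val t) a = tnth (val t) b -> i != a -> i != b ->
  degenerate (val (del_face t i)).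
Proof.
move=> ab tab ia ib.
have [j [j' [ea eb jj' _]]] := consecutive_lift (val t) ab ia ib.
by exists j, j'; split=> //; rewrite !tnth_mktuple -ea -eb.
Qed.

Lemma act_face_degenerate n (t : dtuple n.+1) (a b i : 'I_n.+1) :
  b = a.+1 :> nat -> tnth (val t) a = tnth (val t) b -> i != a -> i != b ->
  degenerate (val (act_face t i)).
Proof.
move=> ab tab ia ib.
have [j [j' [ea eb jj' ltE]]] := consecutive_lift (val t) ab ia ib.
by exists j, j'; split=> //; rewrite !tnth_mktuple -ea -eb ltE tab.
Qed.

Lemma del_face_eq n (t : dtuple n.+1) (a b : 'I_n.+1) :
  b = a.+1 :> nat -> tnth (val t) a = tnth (val t) b ->
  del_face t a = del_face t b.
Proof.
move=> ab tab; apply/val_inj/eq_from_tnth => j; rewrite !tnth_mktuple.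
have [ja|ja] := eqVneq (j : nat) a.
  have -> : lift a j = b by apply/val_inj; rewrite /= /bump; lia.
  by have -> : lift b j = a by apply/val_inj; rewrite /= /bump; lia.
by congr tnth; apply/val_inj; rewrite /= /bump; lia.
Qed.

Lemma act_face_eq n (t : dtuple n.+1) (a b : 'I_n.+1) :
  b = a.+1 :> nat -> tnth (val t) a = tnth (val t) b ->
  act_face t a = act_face t b.
Proof.
move=> ab tab; apply/val_inj/eq_from_tnth => j; rewrite !tnth_mktuple.
have raa : pq_rel (tnth (val t) a) (tnth (val t) a).
  by have /asboolP dt := valP t; rewrite {2}tab; apply: dt; rewrite ab.
have [ja|ja] := eqVneq (j : nat) a.
  have -> : lift a j = b by apply/val_inj; rewrite /= /bump; lia.
  have -> : lift b j = a by apply/val_inj; rewrite /= /bump; lia.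
  have -> : (j < a)%N = false by lia.
  have -> : (j < b)%N by lia.
  by rewrite -tab /star; have [-> _] := pq3 raa.
have -> : lift a j = lift b j by apply/val_inj; rewrite /= /bump; lia.
have -> : (j < b)%N = (j < a)%N by lia.
by rewrite tab.
Qed.

Lemma bd_CPD n (c : CPR n.+1) : c \in @CPD n.+1 -> bd c \in @CPD n.
Proof.
move=> /asboolP hc; refine (hc (fun v => bd v \in @CPD n) _ _ _).
- by rewrite raddf0 rpred0.
- by move=> u v hu hv; rewrite raddfB rpredB.
move=> _ [t [a [b [ab tab]]] ->]; rewrite /bd liftU scale1r.
have neab : b != a by apply/eqP => e; rewrite e in ab; lia.
rewrite (bigD1 a) //= (bigD1 b) //= addrA.
rewrite -(del_face_eq ab tab) -(act_face_eq ab tab) ab.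
rewrite -scalerDl [X in X *: _](_ : _ = 0) ?scale0r ?add0r; last first.
  by rewrite [in X in _ + X]exprS mulN1r subrr.
apply: rpred_sum => i /andP[ia ib].
have h : (<< del_face t i >> - << act_face t i >> : CPR n) \in @CPD n.
  apply: rpredB; apply: mem_CPD.
    exact: del_face_degenerate ab tab ia ib.
  exact: act_face_degenerate ab tab ia ib.
by rewrite -signr_odd; case: odd; rewrite ?expr1 ?expr0 ?scaleN1r ?scale1r ?rpredN.
Qed.

(* The representative is irrelevant, by bdQ_class. *)
Definition bdQ n (c : CPQ n.+1) : CPQ n :=
  classPQ (bd (generic_quotient.repr (c : Quotient.quot _))).

Lemma bdQ_class n (c : CPR n.+1) : bdQ (classPQ c) = classPQ (bd c).
Proof.
apply/classPQ_eq; rewrite -raddfB; apply: bd_CPD; apply/classPQ_eq.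
exact: reprK.
Qed.

Lemma classPQ_surj n (u : CPQ n) : exists c, u = classPQ c.
Proof.
exists (generic_quotient.repr (u : Quotient.quot _)); exact/esym/reprK.
Qed.

Lemma classPQB n (a b : CPR n) : classPQ (a - b) = classPQ a - classPQ b.
Proof. by rewrite /classPQ raddfB. Qed.

Lemma bdQ_is_zmod_morphism n : zmod_morphism (@bdQ n).
Proof.
move=> u v; have [a ->] := classPQ_surj u; have [b ->] := classPQ_surj v.
by rewrite -classPQB !bdQ_class raddfB classPQB.
Qed.

HB.instance Definition _ n :=
  GRing.isZmodMorphism.Build (CPQ n.+1) (CPQ n) (@bdQ n)
    (@bdQ_is_zmod_morphism n).

Definition ZPQ n : {pred CPQ n.+1} := fun c => bdQ c == 0.

Lemma ZPQ_zmod_closed n : zmod_closed (@ZPQ n).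
Proof.
split=> [|u v /eqP hu /eqP hv]; apply/eqP; first exact: raddf0.
by rewrite raddfB /= hu hv subrr.
Qed.

HB.instance Definition _ n :=
  GRing.isZmodClosed.Build (CPQ n.+1) (@ZPQ n) (@ZPQ_zmod_closed n).

Record cyclePQ n := CyclePQ { cycle_val :> CPQ n.+1; _ : cycle_val \in @ZPQ n }.
HB.instance Definition _ n := [isSub for @cycle_val n].
HB.instance Definition _ n := [Choice of cyclePQ n by <:].
HB.instance Definition _ n := [SubChoice_isSubZmodule of cyclePQ n by <:].

Definition BPQ n : {pred cyclePQ n} := fun z =>
  `[< exists b : CPQ n.+2, bdQ b = cycle_val z >].

Lemma BPQ_zmod_closed n : zmod_closed (@BPQ n).
Proof.
split=> [|u v /asboolP[a ea] /asboolP[b eb]]; apply/asboolP.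
  by exists 0; rewrite raddf0.
by exists (a - b); rewrite raddfB /= ea eb.
Qed.

HB.instance Definition _ n :=
  GRing.isZmodClosed.Build (cyclePQ n) (@BPQ n) (@BPQ_zmod_closed n).

(* HPQ n is the homology group in degree n.+1. *)
Definition HPQ n : zmodType := Quotient.quot (@BPQ n).

Definition classH n (c : CPQ n.+1) (hc : bdQ c = 0) : HPQ n :=
  \pi_(Quotient.quot (@BPQ n)) (CyclePQ (introT eqP hc)).

End Homology.

(* A diagram with components indexed by 'I_s is given by its signed Gauss
   code.  A passage (c, true) is the over-passage through the crossing c, and
   (c, false) the under-passage; dia_next sends a passage to the following one
   along the oriented component.  A component without crossings is an index
   outside the range of dia_comp.  A crossing is positive when (direction of
   the over-strand, direction of the under-strand) is a positive basis.  For a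
   connected planar diagram the code determines the diagram on the sphere up
   to isotopy; for a split one it forgets in which regions the pieces lie. *)
Record gaussDiagram (s : nat) := GaussDiagram {
  crossing : finType;
  dia_next : {perm crossing * bool};
  dia_comp : crossing * bool -> 'I_s;
  dia_pos : crossing -> bool;
  dia_compP : forall p q,
    (dia_comp p == dia_comp q) = fconnect dia_next p q
}.

Section Gauss.
Variables (s : nat) (D : gaussDiagram s).

Definition passage : finType := (crossing D * bool)%type.

Definition dia_prev (p : passage) : passage := ((dia_next D)^-1)%g p.

(* The four ends of strands at a crossing: (p, true) is the end by which the
   strand leaves the passage p, and (p, false) the end by which it arrives. *)
Definition dart : finType := (passage * bool)%type.

Definition dart_edge (d : dart) : dart :=
  if d.2 then (dia_next D d.1, false) else (dia_prev d.1, true).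

(* The next end counterclockwise around the crossing. *)
Definition dart_node (d : dart) : dart :=
  let: ((c, o), t) := d in ((c, ~~ o), if o == dia_pos c then t else ~~ t).

Definition dart_face (d : dart) : dart := dart_node (dart_edge d).

Definition dart_link : rel dart :=
  fun d e => (dart_edge d == e) || (dart_node d == e).

(* Euler's formula #edges + #crossings + #faces = #darts + 2 #pieces. *)
Definition planar : bool :=
  fcard dart_edge predT + fcard dart_node predT + fcard dart_face predT
    == #|dart| + (n_comp dart_link predT).*2.

(* inl p is the edge that starts at the passage p; inr i is the circle
   forming the component i when this component goes through no crossing. *)
Definition is_edge (e : passage + 'I_s) : bool :=
  match e with
  | inl _ => true
  | inr i => [forall p : passage, dia_comp p != i]
  end.

Definition edge := {e : passage + 'I_s | is_edge e}.

(* inl c is the arc that starts at the under-passage through c; inr i is the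
   closed arc forming the component i when it has no under-passage. *)
Definition is_arc (a : crossing D + 'I_s) : bool :=
  match a with
  | inl _ => true
  | inr i => [forall c : crossing D, dia_comp (c, false) != i]
  end.

Definition arc := {a : crossing D + 'I_s | is_arc a}.

Definition arc_comp (a : arc) : 'I_s :=
  match val a with
  | inl c => dia_comp (c, false)
  | inr i => i
  end.

(* The arc containing an edge starts at the last under-passage met, going
   backwards from the beginning of the edge. *)
Definition arc_of (e : passage + 'I_s) : crossing D + 'I_s :=
  match e with
  | inl p => if ohead [seq q <- orbit dia_prev p | ~~ q.2] is Some q
             then inl q.1 else inr (dia_comp p)
  | inr i => inr i
  end.

Lemma orbit_comp (p q : passage) :
  (q \in orbit dia_prev p) = (dia_comp q == dia_comp p).
Proof.
have nextI := @perm_inj _ (dia_next D).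
have prevE : dia_prev =1 finv (dia_next D).
  by move=> r; apply: (nextI); rewrite (f_finv nextI) /dia_prev permKV.
rewrite -fconnect_orbit (eq_fconnect prevE) (same_fconnect_finv nextI).
by rewrite -dia_compP eq_sym.
Qed.

Lemma is_arc_of (e : passage + 'I_s) : is_edge e -> is_arc (arc_of e).
Proof.
case: e => [p _|i /forallP h] /=; last by apply/forallP => c; apply: h.
case E: [seq q <- orbit dia_prev p | ~~ q.2] => [|q r] //=.
apply/forallP => c; apply/negP => cp.
suff : (c, false) \in [seq q <- orbit dia_prev p | ~~ q.2] by rewrite E.
by rewrite mem_filter orbit_comp.
Qed.

Definition edge_arc (e : edge) : arc := exist _ (arc_of (val e)) (is_arc_of (valP e)).

Definition edge_after (p : passage) : edge := exist _ (inl p) isT.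

Definition arc_after (p : passage) : arc := edge_arc (edge_after p).

Definition over_arc (c : crossing D) : arc := arc_after (c, true).
Definition under_in (c : crossing D) : arc := arc_after (dia_prev (c, false)).
Definition under_out (c : crossing D) : arc := arc_after (c, false).

(* The normal of an arc points to the left of the arc, and the under-strand of
   a positive crossing goes from the right to the left of the over-strand. *)
Definition under_source (c : crossing D) : arc :=
  if dia_pos c then under_in c else under_out c.
Definition under_target (c : crossing D) : arc :=
  if dia_pos c then under_out c else under_in c.

Lemma arc_comp_after (p : passage) : arc_comp (arc_after p) = dia_comp p.
Proof.
rewrite /arc_comp /=; case E: [seq q <- orbit dia_prev p | ~~ q.2] => [|q r] //=.
have : q \in [seq q <- orbit dia_prev p | ~~ q.2] by rewrite E mem_head.
rewrite mem_filter orbit_comp => /andP[q2 /eqP <-].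
by case: q q2 {E} => c [].
Qed.

Lemma dia_comp_prev (p : passage) : dia_comp (dia_prev p) = dia_comp p.
Proof. by apply/eqP; rewrite -orbit_comp -fconnect_orbit fconnect1. Qed.

Lemma arc_comp_source (c : crossing D) :
  arc_comp (under_source c) = dia_comp (c, false).
Proof.
by rewrite /under_source; case: dia_pos; rewrite arc_comp_after ?dia_comp_prev.
Qed.

Section Colorings.
Variables (X : partialQuandle) (R : rel 'I_s).

Definition good (c : crossing D) : bool :=
  R (dia_comp (c, false)) (dia_comp (c, true)).

Record coloringII := ColoringII {
  color :> arc -> X;
  color_mono : forall a b : arc,
    R (arc_comp a) (arc_comp b) -> pq_rel (color a) (color b);
  color_good : forall c, good c ->
    pq_op (color (under_source c)) (color (over_arc c))
      = Some (color (under_target c));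
  color_bad : forall c, ~~ good c -> color (under_in c) = color (under_out c)
}.

Definition Gcr (i : 'I_s) :=
  {c : crossing D | good c && (dia_comp (c, false) == i)}.

Definition crossing_pair (f : coloringII) (c : crossing D) :
    2.-tuple {classic X} :=
  [tuple (f (under_source c) : {classic X}); (f (over_arc c) : {classic X})].

Lemma crossing_pair_defect0 (f : coloringII) (c : crossing D) :
  good c -> defect0 (crossing_pair f c).
Proof.
move=> gc j k; case: j => [[|[|//]] hj]; case: k => [[|[|//]] hk] //= _.
rewrite !(tnth_nth (f (over_arc c))) /=.
by apply: color_mono; rewrite arc_comp_source arc_comp_after.
Qed.

Definition crossing_dtuple (f : coloringII) (i : 'I_s) (c : Gcr i) :
    dtuple X 2 :=
  exist _ (crossing_pair f (val c))
    (asboolT (crossing_pair_defect0 f (proj1 (andP (valP c))))).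

Definition z_chain (f : coloringII) (i : 'I_s) : CPR X 2 :=
  \sum_(c : Gcr i) (if dia_pos (val c) then << crossing_dtuple f c >>
                    else - << crossing_dtuple f c >>).

End Colorings.

End Gauss.

Record linkDiagram (s : nat) := LinkDiagram {
  link_gauss :> gaussDiagram s;
  link_planar : planar link_gauss
}.

Section Moves.
Variables (s : nat) (R : rel 'I_s).

Section Removal.
Variables (E D : gaussDiagram s).

Definition lift_passage (h : crossing D -> crossing E) (p : passage D) :
    passage E :=
  (h p.1, p.2).

(* The last passage kept in D at or before the passage p of E. *)
Definition last_kept (h : crossing D -> crossing E) (p : passage E) :
    option (passage D) :=
  ohead (pmap (fun r => [pick q | lift_passage h q == r])
              (orbit (@dia_prev s E) p)).

(* D is obtained from E by deleting the passages through the crossings in cs: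
   the passage before p in D is the first one kept when running backwards from
   p in E. *)
Record removal (cs : seq (crossing E)) := Removal {
  rem_emb : crossing D -> crossing E;
  rem_inj : injective rem_emb;
  rem_codom : forall c : crossing E, (c \notin cs) <-> exists d, rem_emb d = c;
  rem_pos : forall d, dia_pos (rem_emb d) = dia_pos d;
  rem_comp : forall p, dia_comp (lift_passage rem_emb p) = dia_comp p;
  rem_prev : forall p : passage D,
    last_kept rem_emb (dia_prev (lift_passage rem_emb p)) = Some (dia_prev p)
}.

(* When the edges of E inside the disk of the move start at the passages
   satisfying inner, the edges e' of E and e of D share a part outside the
   disk. *)
Definition removal_outer (cs : seq (crossing E)) (r : removal cs)
    (inner : pred (passage E)) (e' : edge E) (e : edge D) : bool :=
  match val e', val e with
  | inl p', inl p => ~~ inner p' && (last_kept (rem_emb r) p' == Some p)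
  | inl p', inr i => [&& ~~ inner p', last_kept (rem_emb r) p' == None
                       & dia_comp p' == i]
  | inr _, inl _ => false
  | inr i', inr i => i' == i
  end.

(* E carries the kink, which is run through from (c, b) to (c, ~~ b). *)
Record move1 := Move1 {
  m1_c : crossing E;
  m1_b : bool;
  m1_next : dia_next E (m1_c, m1_b) = (m1_c, ~~ m1_b);
  m1_permitted : R (dia_comp (m1_c, m1_b)) (dia_comp (m1_c, m1_b));
  m1_rem : removal [:: m1_c]
}.

Definition move1_inner (m : move1) : pred (passage E) :=
  pred1 (m1_c m, m1_b m).

(* E carries the bigon, whose over-strand runs from c to d; the under-strand
   runs from c to d if m2_par holds, and from d to c otherwise. *)
Record move2 := Move2 {
  m2_c : crossing E;
  m2_d : crossing E;
  m2_par : bool;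
  m2_over : dia_next E (m2_c, true) = (m2_d, true);
  m2_under : if m2_par then dia_next E (m2_c, false) = (m2_d, false)
             else dia_next E (m2_d, false) = (m2_c, false);
  m2_pos : dia_pos m2_c != dia_pos m2_d;
  m2_permitted : R (dia_comp (m2_c, false)) (dia_comp (m2_c, true));
  m2_rem : removal [:: m2_c; m2_d]
}.

Definition move2_inner (m : move2) : pred (passage E) :=
  pred2 (m2_c m, true) (if m2_par m then m2_c m else m2_d m, false).

(* The passages x and y are consecutive, x being the first one iff b holds. *)
Definition consecutive (b : bool) (x y : passage E) : Prop :=
  if b then dia_next E x = y else dia_next E y = x.

(* In the triangle, p is the crossing of the top and middle strands, q that of
   the top and bottom strands, and r that of the middle and bottom strands.
   Let et, em, eb be the signs telling whether the top strand runs from p to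
   q, the middle one from p to r and the bottom one from q to r.  For three
   lines in the plane, the sign of det(q - p, r - p) is
     et em sign(p) = et eb sign(q) = em eb sign(r),
   whence m3_triangle.  The move exchanges, on each of the three strands, the
   two passages on it. *)
Definition triangle_swap (p q r : crossing E) : {perm passage E} :=
  (tperm (p, true) (q, true) * tperm (p, false) (r, true)
    * tperm (q, false) (r, false))%g.

Record move3 := Move3 {
  m3_p : crossing E;
  m3_q : crossing E;
  m3_r : crossing E;
  m3_uniq : uniq [:: m3_p; m3_q; m3_r];
  m3_et : bool;
  m3_em : bool;
  m3_eb : bool;
  m3_top : consecutive m3_et (m3_p, true) (m3_q, true);
  m3_middle : consecutive m3_em (m3_p, false) (m3_r, true);
  m3_bottom : consecutive m3_eb (m3_q, false) (m3_r, false);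
  m3_triangle :
    m3_et (+) m3_em (+) dia_pos m3_p = m3_et (+) m3_eb (+) dia_pos m3_q /\
    m3_et (+) m3_em (+) dia_pos m3_p = m3_em (+) m3_eb (+) dia_pos m3_r;
  m3_permitted_middle : R (dia_comp (m3_p, false)) (dia_comp (m3_p, true));
  m3_permitted_bottom : R (dia_comp (m3_q, false)) (dia_comp (m3_q, true));
  m3_iso : crossing E -> crossing D;
  m3_bij : bijective m3_iso;
  m3_pos : forall c, dia_pos (m3_iso c) = dia_pos c;
  m3_comp : forall x : passage E, dia_comp (m3_iso x.1, x.2) = dia_comp x;
  m3_next : forall x y : passage E, dia_next E x = y ->
    let x' := triangle_swap m3_p m3_q m3_r x in
    let y' := triangle_swap m3_p m3_q m3_r y in
    dia_next D (m3_iso x'.1, x'.2) = (m3_iso y'.1, y'.2)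
}.

Definition move3_inner (m : move3) : pred (passage E) :=
  pred3 (if m3_et m then m3_p m else m3_q m, true)
        (if m3_em m then (m3_p m, false) else (m3_r m, true))
        (if m3_eb m then m3_q m else m3_r m, false).

Definition move3_outer (m : move3) (e' : edge E) (e : edge D) : bool :=
  match val e', val e with
  | inl x, inl y =>
      let x' := triangle_swap (m3_p m) (m3_q m) (m3_r m) x in
      ~~ move3_inner m x && (y == (m3_iso m x'.1, x'.2))
  | inr i', inr i => i' == i
  | _, _ => false
  end.

Variant reidemeister :=
  | MoveI of move1
  | MoveII of move2
  | MoveIII of move3.

Definition move_outer (m : reidemeister) : edge E -> edge D -> bool :=
  match m with
  | MoveI m => removal_outer (m1_rem m) (move1_inner m)
  | MoveII m => removal_outer (m2_rem m) (move2_inner m)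
  | MoveIII m => move3_outer m
  end.

Definition agree_outside (X : partialQuandle) (m : reidemeister)
    (g : coloringII E X R) (f : coloringII D X R) : Prop :=
  forall (e' : edge E) (e : edge D),
    move_outer m e' e -> g (edge_arc e') = f (edge_arc e).

End Removal.

(* A permitted move, in either direction, from D to D' transforms the coloring
   f into the coloring f'. *)
Definition reidemeister_related (X : partialQuandle) (D D' : gaussDiagram s)
    (f : coloringII D X R) (f' : coloringII D' X R) : Prop :=
  (exists m : reidemeister D D', agree_outside m f f') \/
  (exists m : reidemeister D' D, agree_outside m f' f).

End Moves.

Definition z_class (X : partialQuandle) (s : nat) (R : rel 'I_s)
    (D : gaussDiagram s) (f : coloringII D X R) (i : 'I_s) : CPQ X 2 :=
  classPQ (z_chain f i).

(* Main.v *)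
From mathcomp Require Import freeg.
From mathcomp Require Import all_boot perm all_algebra boolp.
Require Import Defs.

Set Implicit Arguments.
Unset Strict Implicit.
Unset Printing Implicit Defensive.

Import GRing.Theory.

Local Open Scope ring_scope.

(** The boundary of a pair (x, y) is (x) - (x * y), so a good crossing of either
sign contributes to the boundary of z_i the color of the under-arc that comes
in minus the color of the under-arc that goes out; a bad crossing would
contribute 0, its two under-arcs having the same color.  Hence the boundary of
z_i is a sum, taken along the component C_i, of the changes of color of its
arcs, and this sum telescopes around the closed curve (z_class_cycle).

For invariance, every crossing outside the disk of a move keeps its signed
pair, since its arcs have parts outside the disk; only the crossings of the
move matter.
- First move: the over-arc of the kink is one of the two under-arcs, and then
  all three arcs have the same color y, since x * y = y forces x = y.  The pair
  (y, y) is degenerate, so it vanishes in the quotient.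
- Second move: the two crossings have the same over-arc and share the under-arc
  between them, which is the source at both or the target at both.  As x is
  determined by y and x * y, the two pairs are equal, and their signs are
  opposite.
- Third move: the crossing of the top and middle strands keeps its pair.  If
  the middle and bottom strands cross badly, the bottom strand does not change
  color there, so its crossing with the top strand keeps its pair as well.
  Otherwise the two remaining crossings give, on one side of the move, the
  pairs (b, t) and (b * t, a * t) up to sign and order, and on the other side
  (b, a) and (b * a, t), or else the four pairs are distributed differently,
  with other signs; here t, a, b are the colors of the top, middle and bottom
  strands in the corner from which the normals of the two upper strands point
  away.  In every case the difference of the two sides is plus or minus the
  boundary of the triple (b, a, t) (bottom_strand_homologous).  The triangle
  condition on the signs of the crossings is what makes r lie on the same side
  of the top strand whether one looks along the middle strand or along the
  bottom one. *)

(** * Chains of a partial quandle *)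

Lemma add_sub_sub (V : zmodType) (a b c d e f : V) :
  a + b - (c + d) - (e + f) = (a - c - e) + (b - d - f).
Proof. by rewrite !opprD [a + b + _]addrACA [LHS]addrACA. Qed.

Lemma sub_sub_subK (V : zmodType) (a b c d : V) :
  a + b - (c + d) - (a - d - (c - b)) = 0.
Proof.
rewrite !opprD !opprK !addrA [LHS](ACl ((1*5)*(2*8)*(3*7)*(4*6))) /=.
by rewrite !subrr !addNr !addr0.
Qed.

Lemma sub_sub_addK (V : zmodType) (a b c d : V) :
  a - b - (c - d) - - (c - a - (d - b)) = 0.
Proof.
rewrite !opprD !opprK !addrA [LHS](ACl ((1*6)*(2*8)*(3*5)*(4*7))) /=.
by rewrite !subrr !addNr !addr0.
Qed.

Section Chains.
Variable X : partialQuandle.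

(** Sending the tuples of nonzero defect to 0 spares every formula about chains
the proofs of defect 0 that the generators carry. *)
Definition tuple_chain n (t : n.-tuple {classic X}) : CPR X n :=
  if insub t is Some u then (<< (u : dtuple X n) >> : {freeg (dtuple X n) / int})
  else 0.

Lemma tuple_chainE n (u : dtuple X n) : tuple_chain (val u) = << u >>.
Proof. by rewrite /tuple_chain valK. Qed.

Lemma bd_tuple_chain n (t : n.+1.-tuple {classic X}) : defect0 t ->
  bd (tuple_chain t) =
  \sum_(i < n.+1) (-1) ^+ i.+1 *:
     (tuple_chain (del_tuple t i) - tuple_chain (act_tuple t i)
      : {freeg (dtuple X n) / int}).
Proof.
move=> /asboolT dt; pose u : dtuple X n.+1 := exist _ t dt.
rewrite -[t]/(val u) tuple_chainE /bd liftU scale1r; apply: eq_bigr => i _.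
rewrite -[del_tuple _ _]/(val (del_face u i)) -[act_tuple _ _]/(val (act_face u i)).
by rewrite !tuple_chainE.
Qed.

Definition single (x : X) : CPR X 1 := tuple_chain [tuple (x : {classic X})].

Definition pair_chain (x y : X) : CPR X 2 :=
  tuple_chain [tuple (x : {classic X}); (y : {classic X})].

Lemma bd_pair (x y : X) : pq_rel x y ->
  bd (pair_chain x y) = single x - single (star x y).
Proof.
move=> xy; rewrite /pair_chain bd_tuple_chain; last first.
  by move=> [[|[|//]] ?] [[|[|//]] ?].
rewrite big_ord_recl big_ord1 subrr scaler0 add0r expr2 mulN1r opprK scale1r.
by congr (tuple_chain _ - tuple_chain _); apply: eq_from_tnth => -[[|//] ?];
  rewrite tnth_mktuple !(tnth_nth y).
Qed.

(** The two faces that omit x coincide, which leaves the four pairs below. *)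
Lemma bd_triple (x y z : X) : pq_rel x y -> pq_rel x z -> pq_rel y z ->
  bd (tuple_chain [tuple (x : {classic X}); (y : {classic X}); (z : {classic X})])
  = (pair_chain x z - pair_chain (star x y) z)
    - (pair_chain x y - pair_chain (star x z) (star y z)).
Proof.
move=> xy xz yz; rewrite bd_tuple_chain; last first.
  by move=> [[|[|[|//]]] ?] [[|[|[|//]]] ?].
rewrite big_ord_recl big_ord_recl big_ord1 subrr scaler0 add0r.
rewrite -[X in X *: _ + _]signr_odd -[X in _ + X *: _]signr_odd /=.
rewrite expr0 expr1 scale1r scaleN1r.
by congr ((tuple_chain _ - tuple_chain _) - (tuple_chain _ - tuple_chain _));
  apply: eq_from_tnth => -[[|[|//]] ?]; rewrite tnth_mktuple !(tnth_nth y).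
Qed.

Lemma bdN n (c : CPR X n.+1) : bd (- c) = - bd c.
Proof. exact: raddfN. Qed.

Lemma bdD n (c d : CPR X n.+1) : bd (c + d) = bd c + bd d.
Proof. exact: raddfD. Qed.

(** Right multiplication by z is undone by the second operation. *)
Lemma star_inj (x y z : X) :
  pq_rel x z -> pq_rel y z -> star x z = star y z -> x = y.
Proof.
have starK u : pq_rel u z -> pq_opb (star u z) z = Some u.
  move=> uz; have [+ _] := pq4 uz; have [+ _] := pq1 uz.
  by rewrite /star; case: pq_op.
by move=> xz yz E; apply: Some_inj; rewrite -!starK // E.
Qed.

(** Since x * y is similar to x, the equation x * y = y makes y related to
itself; then y * y = y, and right multiplication by y is injective. *)
Lemma star_fixed (x y : X) : pq_rel x y -> star x y = y -> x = y.
Proof.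
move=> xy E; have [yy _] := star_similar xy y; rewrite E in yy.
have {}yy : pq_rel y y by apply/yy.
by apply: (star_inj xy yy); rewrite E /star; have [-> _] := pq3 yy.
Qed.

(** * Homologous chains *)

(** Homology in the quotient complex, expressed on representatives: equality
modulo boundaries and degenerate chains. *)
Definition homologous n (c c' : CPR X n.+1) : Prop :=
  exists b : CPR X n.+2, c - c' - bd b \in @CPD X n.+1.

Lemma homologous_refl n (c : CPR X n.+1) : homologous c c.
Proof. by exists 0; rewrite raddf0 subrr subr0 rpred0. Qed.

Lemma homologousN n (c c' : CPR X n.+1) :
  homologous c c' -> homologous (- c) (- c').
Proof. by case=> b h; exists (- b); rewrite bdN -!opprD rpredN. Qed.

Lemma homologous_sym n (c c' : CPR X n.+1) : homologous c c' -> homologous c' c.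
Proof.
by case=> b h; exists (- b); rewrite bdN -[c' - c]opprB -opprD rpredN.
Qed.

Lemma homologousD n (c c' d d' : CPR X n.+1) :
  homologous c c' -> homologous d d' -> homologous (c + d) (c' + d').
Proof.
move=> [b h] [b' h']; exists (b + b').
rewrite bdD (_ : _ - _ = (c - c' - bd b) + (d - d' - bd b')).
  exact: rpredD.
exact: add_sub_sub.
Qed.

Lemma degenerate_homologous0 n (c : CPR X n.+1) :
  c \in @CPD X n.+1 -> homologous c 0.
Proof. by exists 0; rewrite [bd _]raddf0 !subr0. Qed.

Lemma homologous_classH n (c c' : CPR X n.+1)
    (hc : bdQ (classPQ c) = 0) (hc' : bdQ (classPQ c') = 0) :
  homologous c c' -> classH hc = classH hc'.
Proof.
case=> b hb; apply/eqP; rewrite -Quotient.idealrBE; apply/asboolP.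
exists (classPQ b); rewrite bdQ_class.
rewrite -[RHS]/(classPQ c - classPQ c') -classPQB; exact/esym/classPQ_eq.
Qed.

Lemma pair_diag_homologous0 (x : X) : homologous (pair_chain x x) 0.
Proof.
apply: degenerate_homologous0; rewrite /pair_chain /tuple_chain.
case: insubP => [u _ uE|_]; last exact: rpred0.
by apply: mem_CPD; rewrite uE; exists ord0, ord_max.
Qed.

Definition signed (e : bool) (c : CPR X 2) : CPR X 2 := if e then c else - c.

Lemma signedD e (c d : CPR X 2) : signed e c + signed e d = signed e (c + d).
Proof. by case: e => //=; rewrite opprD. Qed.

Lemma signedB e (c d : CPR X 2) : signed e c + signed (~~ e) d = signed e (c - d).
Proof. by case: e => //=; rewrite opprB addrC. Qed.

Lemma homologous_signed e (c c' : CPR X 2) :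
  homologous c c' -> homologous (signed e c) (signed e c').
Proof. by case: e => //; apply: homologousN. Qed.

(** The basic case of the third move, in which the two crossings on the bottom
strand have the same sign: the difference is the boundary of (x, y, z). *)
Lemma triangle_homologous (x y z : X) :
  pq_rel x y -> pq_rel x z -> pq_rel y z ->
  homologous (pair_chain x z + pair_chain (star x z) (star y z))
             (pair_chain x y + pair_chain (star x y) z).
Proof.
move=> xy xz yz.
exists (tuple_chain
          [tuple (x : {classic X}); (y : {classic X}); (z : {classic X})]).
by rewrite bd_triple // sub_sub_subK rpred0.
Qed.

(** The case in which the two crossings have opposite signs: the same boundary,
with its four terms distributed differently. *)
Lemma triangle_homologousB (x y z : X) :
  pq_rel x y -> pq_rel x z -> pq_rel y z ->
  homologous (pair_chain (star x y) z - pair_chain (star x z) (star y z))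
             (pair_chain x z - pair_chain x y).
Proof.
move=> xy xz yz.
exists (- tuple_chain
          [tuple (x : {classic X}); (y : {classic X}); (z : {classic X})]).
by rewrite bdN bd_triple // sub_sub_addK rpred0.
Qed.

(** The third move seen from the bottom strand.  The strand is followed from its
crossing q with the top strand to its crossing r with the middle one, as they
are met before the move; it has there the colors b0, b1, b2, and between the
same ends b0, b', b2 after the move.  The boolean tau tells whether, before the
move, r lies on the target side of the top strand, and mu whether q lies on the
source side of the middle strand; e tells whether the strand is oriented from q
to r.  Hence e == tau and e == mu are the signs of q and r, and m and m' are the
colors of the middle strand above r before and after the move.  The color
called x in the two lemmas above is the one of b0, b1, b2, b' that is the source
of both its neighbors; it is different in each of the four cases. *)
Lemma bottom_strand_homologous (e tau mu : bool) (t a b0 b1 b2 b' : X)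
    (m := if tau then star a t else a) (m' := if tau then a else star a t) :
  pq_rel a t ->
  [/\ pq_rel b0 t, pq_rel b1 t, pq_rel b2 t & pq_rel b' t] ->
  [/\ pq_rel b0 a, pq_rel b1 a, pq_rel b2 a & pq_rel b' a] ->
  star (if tau then b0 else b1) t = (if tau then b1 else b0) ->
  star (if tau then b' else b2) t = (if tau then b2 else b') ->
  star (if mu then b1 else b2) m = (if mu then b2 else b1) ->
  star (if mu then b0 else b') m' = (if mu then b' else b0) ->
  homologous
    (signed (e == tau) (pair_chain (if tau then b0 else b1) t)
     + signed (e == mu) (pair_chain (if mu then b1 else b2) m))
    (signed (e == tau) (pair_chain (if tau then b' else b2) t)
     + signed (e == mu) (pair_chain (if mu then b0 else b') m')).
Proof.
rewrite {}/m {}/m' => a_t [t0 t1 t2 t'] [a0 a1 a2 a'].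
case: tau; case: mu => qE qD rE rD; rewrite ?eqb_id ?eqbF_neg.
- rewrite !signedD [pair_chain b' t + _]addrC; apply: homologous_signed.
  by rewrite -qE -rD; apply: triangle_homologous.
- rewrite !signedB; apply: homologous_signed.
  by rewrite -rD -qD; apply: triangle_homologousB.
- rewrite -{2 4}[e]negbK !signedB; apply/homologous_signed/homologous_sym.
  by rewrite -rE -qE; apply: triangle_homologousB.
- rewrite !signedD addrC; apply/homologous_signed/homologous_sym.
  by rewrite -rE -qD; apply: triangle_homologous.
Qed.

End Chains.

(** * Colors along a component *)

Section Crossings.
Variables (s : nat) (R : rel 'I_s).

Section Diagram.
Variable D : gaussDiagram s.

Lemma dia_prevK : cancel (@dia_next s D) (@dia_prev s D).
Proof. exact: permK. Qed.

Lemma dia_nextK : cancel (@dia_prev s D) (@dia_next s D).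
Proof. exact: permKV. Qed.

Lemma dia_comp_next (p : passage D) : dia_comp (dia_next D p) = dia_comp p.
Proof. by rewrite -dia_comp_prev dia_prevK. Qed.

(** Going backwards from the preceding passage, one meets the same passages in
the same cyclic order, with p now met last. *)
Lemma orbit_dia_prev (p : passage D) : exists r,
  orbit (@dia_prev s D) p = p :: r /\
  orbit (@dia_prev s D) (dia_prev p) = rcons r p.
Proof.
have prevI : injective (@dia_prev s D) := can_inj dia_nextK.
exists (traject (@dia_prev s D) (dia_prev p) (order (@dia_prev s D) p).-1).
rewrite /orbit order_id_cycle ?cycle_orbit // -orderSpred; split=> //.
by rewrite trajectSr -iterSr orderSpred iter_order.
Qed.

(** An over-passage does not interrupt the arc: moving it from the first to the
last place of the orbit does not change the first under-passage found. *)
Lemma arc_after_over (c : crossing D) :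
  arc_after (dia_prev (c, true)) = arc_after (c, true) :> arc D.
Proof.
apply: val_inj => /=; have [r [-> ->]] := orbit_dia_prev (c, true).
by rewrite filter_rcons /= dia_comp_prev.
Qed.

End Diagram.

Section Colored.
Variables (X : partialQuandle) (D : gaussDiagram s) (f : coloringII D X R).

Definition color_after (p : passage D) : X := f (arc_after p).
Definition color_before (p : passage D) : X := f (arc_after (dia_prev p)).

Lemma before_over c : color_before (c, true) = color_after (c, true).
Proof. by rewrite /color_before arc_after_over. Qed.

Lemma before_next p : color_before (dia_next D p) = color_after p.
Proof. by rewrite /color_before dia_prevK. Qed.

Lemma under_sourceE c : f (under_source c) =
  if dia_pos c then color_before (c, false) else color_after (c, false).
Proof. by rewrite /under_source; case: dia_pos. Qed.

Lemma under_targetE c : f (under_target c) =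
  if dia_pos c then color_after (c, false) else color_before (c, false).
Proof. by rewrite /under_target; case: dia_pos. Qed.

Lemma color_rule c : good R c ->
  star (f (under_source c)) (color_after (c, true)) = f (under_target c).
Proof. by move=> gc; rewrite /star (color_good f gc). Qed.

Lemma passage_rel x y : R (dia_comp x) (dia_comp y) ->
  [/\ pq_rel (color_before x) (color_before y),
      pq_rel (color_before x) (color_after y),
      pq_rel (color_after x) (color_before y)
    & pq_rel (color_after x) (color_after y)].
Proof.
by move=> xy; split; apply: color_mono; rewrite !arc_comp_after ?dia_comp_prev.
Qed.

Lemma source_rel c : good R c ->
  pq_rel (f (under_source c)) (color_after (c, true)).
Proof.
by move=> gc; apply: color_mono; rewrite arc_comp_source arc_comp_after.
Qed.

Lemma under_after_bad c :
  ~~ good R c -> color_before (c, false) = color_after (c, false).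
Proof. exact: color_bad. Qed.

(** * The chain of a component is a cycle *)

(** The term of the crossing c in z_i, extended by 0 to all crossings, so
that the index set of the sum does not depend on i. *)
Definition weight (i : 'I_s) (c : crossing D) : CPR X 2 :=
  if good R c && (dia_comp (c, false) == i)
  then signed (dia_pos c) (pair_chain (f (under_source c)) (color_after (c, true)))
  else 0.

Lemma z_chainE i : z_chain f i = \sum_c weight i c.
Proof.
rewrite /weight -big_mkcond big_sub /z_chain; apply: eq_bigr => c _.
by rewrite -(tuple_chainE (crossing_dtuple f c)).
Qed.

(** The sign of the crossing disappears: it also decides which of the two
under-arcs is the source. *)
Lemma bd_weight i c : bd (weight i c) =
  if dia_comp (c, false) == i
  then single (color_before (c, false)) - single (color_after (c, false)) else 0.
Proof.
rewrite /weight; case: ifP => [/andP[gc ->]|]; last first.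
  rewrite [bd 0]raddf0; case: ifP => // _; rewrite andbT => /negbT gc.
  by rewrite under_after_bad // subrr.
have := bd_pair (source_rel gc); rewrite color_rule // under_sourceE under_targetE.
by case: dia_pos => /= E; rewrite ?bdN E ?opprB.
Qed.

(** The changes of color add up to 0 around the component, the color before a
passage being the color after the preceding one; the over-passages, where the
color does not change, are included to make the sum telescope. *)
Lemma z_class_cycle i : bdQ (z_class f i) = 0.
Proof.
rewrite /z_class bdQ_class z_chainE [bd _]raddf_sum /=.
pose F (p : passage D) :=
  if dia_comp p == i then single (color_before p) - single (color_after p) else 0.
transitivity (classPQ (\sum_p F p)).
  congr classPQ; rewrite (eq_bigr (fun p => F (p.1, p.2))); last by case.
  rewrite -(pair_bigA _ (fun c b => F (c, b))) /=.
  apply: eq_bigr => c _; rewrite bd_weight big_bool /= /F before_over subrr.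
  by rewrite if_same add0r.
rewrite /F -big_mkcond sumrB.
rewrite (reindex_inj (can_inj (@dia_prevK D))) /=.
rewrite (eq_big (fun p => dia_comp p == i) (fun p => single (color_after p))).
- by rewrite subrr /classPQ [LHS]raddf0.
- by move=> p; rewrite dia_comp_next.
- by move=> p _; rewrite before_next.
Qed.

End Colored.

Lemma eq_weight (X : partialQuandle) (D D' : gaussDiagram s)
    (f : coloringII D X R) (f' : coloringII D' X R) (i : 'I_s)
    (c : crossing D) (c' : crossing D') :
  dia_pos c = dia_pos c' ->
  (forall b, dia_comp (c, b) = dia_comp (c', b)) ->
  color_before f (c, false) = color_before f' (c', false) ->
  (forall b, color_after f (c, b) = color_after f' (c', b)) ->
  weight f i c = weight f' i c'.
Proof.
move=> posE compE inE outE.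
by rewrite /weight /good !under_sourceE posE !compE inE !outE.
Qed.

(** * The first and second moves *)

Section Moves.
Variables (X : partialQuandle) (E D : gaussDiagram s).
Variables (g : coloringII E X R) (f : coloringII D X R) (i : 'I_s).

Section Removal.
Variables (cs : seq (crossing E)) (r : removal D cs) (inner : pred (passage E)).
Hypothesis inner_removed : forall x,
  inner x -> (x.1 \in cs) && ((dia_next E x).1 \in cs).
Hypothesis agree : forall (e' : edge E) (e : edge D),
  removal_outer r inner e' e -> g (edge_arc e') = f (edge_arc e).

Local Notation h := (rem_emb r).

Lemma emb_kept d : h d \notin cs.
Proof. by apply/(rem_codom r); exists d. Qed.

Lemma last_kept_emb (p : passage D) : last_kept h (lift_passage h p) = Some p.
Proof.
rewrite /last_kept /orbit -orderSpred /=; case: pickP => [q /eqP|/(_ p)].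
  by case: q p => [c b] [c' b'] [/rem_inj -> ->].
by rewrite eqxx.
Qed.

Lemma removal_after p : color_after g (lift_passage h p) = color_after f p.
Proof.
apply: agree; rewrite /removal_outer /= last_kept_emb eqxx andbT.
by apply/negP => /inner_removed; rewrite (negbTE (emb_kept _)).
Qed.

Lemma removal_before p : color_before g (lift_passage h p) = color_before f p.
Proof.
apply: agree; rewrite /removal_outer /= rem_prev eqxx andbT.
by apply/negP => /inner_removed; rewrite dia_nextK (negbTE (emb_kept _)) andbF.
Qed.

(** No edge at a remaining crossing lies inside the disk, so the remaining
crossings keep their signed pairs. *)
Lemma removal_z_chain : uniq cs ->
  z_chain g i = \sum_(c <- cs) weight g i c + z_chain f i.
Proof.
move=> ucs; rewrite !z_chainE (bigID (mem cs)) /= -big_uniq //; congr (_ + _).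
rewrite (eq_bigl (mem [set h d | d in [set: crossing D]])); last first.
  move=> c /=; apply/idP/imsetP => [/(rem_codom r)[d <-]|[d _ ->]].
    by exists d; rewrite ?inE.
  exact: emb_kept.
rewrite big_imset /=; last by move=> x y _ _; apply: rem_inj.
rewrite (eq_bigl xpredT) => [|d]; last by rewrite inE.
apply: eq_bigr => d _; apply: eq_weight => [|b||b].
- exact: rem_pos.
- exact: (rem_comp r (d, b)).
- exact: (removal_before (d, false)).
- exact: (removal_after (d, b)).
Qed.

End Removal.

(** The kink makes the over-arc continue directly into the under-arc, on one side
or the other, so the pair of the new crossing is degenerate. *)
Lemma move1_homologous (m : move1 R E D) :
  agree_outside (MoveI m) g f -> homologous (z_chain g i) (z_chain f i).
Proof.
move=> agree; set c := m1_c m.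
have nextE := m1_next m; rewrite -/c in nextE.
rewrite (removal_z_chain _ agree) => [|x /eqP ->|//]; last first.
  by rewrite nextE !inE eqxx.
rewrite big_seq1 -[X in homologous _ X]add0r; apply: homologousD; last first.
  exact: homologous_refl.
rewrite /weight; case: ifP => [/andP[gc _]|_]; last exact: homologous_refl.
have touch : color_before g (c, false) = color_after g (c, true) \/
             color_after g (c, false) = color_after g (c, true).
  move: nextE; case: m1_b => /= nextE; [left|right].
    by rewrite -nextE before_next.
  by rewrite -before_next nextE before_over.
have rel := source_rel g gc; have rule := color_rule g gc.
have -> : g (under_source c) = color_after g (c, true).
  move: rel rule; rewrite under_sourceE under_targetE.
  by case: dia_pos touch => -[] // -> rel rule; apply: (star_fixed rel rule).
rewrite -[X in homologous _ X](_ : signed (dia_pos c) 0 = 0).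
  exact/homologous_signed/pair_diag_homologous0.
by case: dia_pos => //=; rewrite oppr0.
Qed.

(** The under-arc between the two crossings of the bigon is, by the opposite
signs, the target of both or the source of both. *)
Lemma move2_homologous (m : move2 R E D) :
  agree_outside (MoveII m) g f -> homologous (z_chain g i) (z_chain f i).
Proof.
move=> agree; set c := m2_c m; set d := m2_d m.
have overE : dia_next E (c, true) = (d, true) := m2_over m.
have underE := m2_under m; rewrite -/c -/d in underE.
have posE : dia_pos d = ~~ dia_pos c.
  by have := m2_pos m; rewrite -/c -/d; do 2!case: dia_pos.
rewrite (removal_z_chain _ agree) => [|x|]; last first.
- rewrite /= inE andbT; apply/eqP => cd; have := m2_pos m.
  by rewrite cd eqxx.
- move=> /orP[] /eqP ->; first by rewrite overE !inE !eqxx orbT.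
  by move: underE; case: m2_par => ->; rewrite !inE !eqxx ?orbT.
rewrite big_cons big_seq1 -[X in homologous _ X]add0r.
apply: homologousD; last exact: homologous_refl.
have compE b : dia_comp (d, b) = dia_comp (c, b).
  case: b; first by rewrite -overE dia_comp_next.
  by move: underE; case: m2_par => <-; rewrite dia_comp_next.
have over_color : color_after g (d, true) = color_after g (c, true).
  by rewrite -before_over -overE before_next.
rewrite /weight /good !compE; case: ifP => [/andP[gc _]|_]; last first.
  by rewrite addr0; apply: homologous_refl.
have gd : good R d by rewrite /good !compE.
suff -> : g (under_source d) = g (under_source c).
  rewrite over_color posE.
  by case: dia_pos => /=; rewrite ?subrr ?addNr; apply: homologous_refl.
suff [] : g (under_target d) = g (under_target c) \/
           g (under_source d) = g (under_source c) => //.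
  move=> targetE; apply: (star_inj _ (source_rel g gc)).
    by rewrite -over_color; apply: source_rel.
  by rewrite -[in LHS]over_color !color_rule.
rewrite !under_sourceE !under_targetE posE; move: underE.
case: m2_par => underE; case: dia_pos => /=.
- by left; rewrite -underE before_next.
- by right; rewrite -underE before_next.
- by right; rewrite -underE before_next.
- by left; rewrite -underE before_next.
Qed.

(** * The third move *)

Section Triangle.
Variable m : move3 R E D.
Hypothesis agree : agree_outside (MoveIII m) g f.

Local Notation p := (m3_p m).
Local Notation q := (m3_q m).
Local Notation r := (m3_r m).
Local Notation inner := (move3_inner m).
Local Notation swap := (triangle_swap p q r).

Definition image_passage (x : passage E) : passage D := (m3_iso m x.1, x.2).

Lemma triangle_swapE :
  [/\ swap (p, true) = (q, true), swap (q, true) = (p, true),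
      swap (p, false) = (r, true), swap (r, true) = (p, false)
    & swap (q, false) = (r, false) /\ swap (r, false) = (q, false)].
Proof.
have := m3_uniq m; rewrite /= !inE negb_or => /and3P[/andP[pq pr] qr _].
have [qp rp rq] : [/\ q != p, r != p & r != q] by split; rewrite eq_sym.
have neqE := (negbTE pq, negbTE pr, negbTE qr, negbTE qp, negbTE rp, negbTE rq).
by split; try split; rewrite /triangle_swap !permM 3!permE /=;
  do 3!rewrite ?xpair_eqE ?eqxx ?neqE /=.
Qed.

Lemma swap_outside c b : c \notin [:: p; q; r] -> swap (c, b) = (c, b).
Proof.
rewrite !inE !negb_or => /and3P[cp cq cr]; rewrite /triangle_swap !permM.
by rewrite !tpermD // xpair_eqE negb_and eq_sym ?cp ?cq ?cr.
Qed.

Lemma swap_involutive : involutive swap.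
Proof.
have [sp sq sp' sr [sq' sr']] := triangle_swapE.
move=> [c b]; have [->|cp] := eqVneq c p; first by case: b; rewrite ?sp ?sq ?sp' ?sr.
have [->|cq] := eqVneq c q; first by case: b; rewrite ?sp ?sq ?sq' ?sr'.
have [->|cr] := eqVneq c r; first by case: b; rewrite ?sp' ?sr ?sq' ?sr'.
by rewrite !swap_outside // !inE !negb_or cp cq cr.
Qed.

Lemma inner_next x : inner x -> dia_next E x = swap x.
Proof.
have [sp sq sp' sr [sq' sr']] := triangle_swapE.
have := (m3_top m, m3_middle m, m3_bottom m); rewrite /consecutive /=.
by case=> -[top middle] bottom /or3P[] /eqP ->;
  [move: top|move: middle|move: bottom]; case: ifP => _ ->.
Qed.

Lemma inner_swap x : inner x -> ~~ inner (swap x).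
Proof.
have [sp sq sp' sr [sq' sr']] := triangle_swapE.
have := m3_uniq m; rewrite /= !inE negb_or => /and3P[/andP[pq pr] qr _].
have [qp rp rq] : [/\ q != p, r != p & r != q] by split; rewrite eq_sym.
have neqE := (negbTE pq, negbTE pr, negbTE qr, negbTE qp, negbTE rp, negbTE rq).
by case/or3P => /eqP ->; rewrite /move3_inner;
  [case: (m3_et m)|case: (m3_em m)|case: (m3_eb m)];
  rewrite ?sp ?sq ?sp' ?sr ?sq' ?sr' /=;
  case: (m3_et m); case: (m3_em m); case: (m3_eb m);
  rewrite ?xpair_eqE ?neqE ?andbF.
Qed.

Lemma outer_after x :
  ~~ inner x -> color_after g x = color_after f (image_passage (swap x)).
Proof. by move=> ix; apply: agree; rewrite /= /move3_outer /= ix eqxx. Qed.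

Lemma outer_before x :
  ~~ inner (dia_prev x) -> color_before g x = color_before f (image_passage (swap x)).
Proof.
move=> ix; rewrite -[LHS]/(color_after g (dia_prev x)) outer_after //.
by rewrite -before_next; congr (color_before f); apply: (m3_next m); apply: dia_nextK.
Qed.

(** On a strand that meets x and then its partner, the color entering the disk
and the color leaving it are the same on both sides of the move, while the two
passages have changed places; the color between them may change. *)
Lemma inner_strand x : inner x ->
  [/\ color_before f (image_passage (swap x)) = color_before g x,
      color_after f (image_passage x) = color_after g (swap x),
      color_before g (swap x) = color_after g x
    & color_before f (image_passage x) = color_after f (image_passage (swap x))].
Proof.
move=> ix; split.
- rewrite outer_before //; apply/negP => iy; have := inner_swap iy.
  by rewrite -inner_next // dia_nextK ix.
- by rewrite outer_after ?inner_swap // swap_involutive.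
- by rewrite -inner_next // before_next.
- rewrite -before_next; congr (color_before f).
  by have := m3_next m (inner_next ix); rewrite /= swap_involutive => ->.
Qed.

(** No edge at another crossing lies inside the triangle. *)
Lemma outside_weight c : c \notin [:: p; q; r] ->
  weight f i (m3_iso m c) = weight g i c.
Proof.
move=> cpqr; have sc b := swap_outside b cpqr.
have out b : ~~ inner (c, b).
  by apply/negP => ic; have := inner_swap ic; rewrite sc ic.
apply: eq_weight => [|b||b].
- exact: m3_pos.
- exact: (m3_comp m (c, b)).
- rewrite outer_before ?sc //; apply/negP => ic.
  have prevE : dia_prev (c, false) = (c, false).
    by apply: (can_inj swap_involutive); rewrite -(inner_next ic) dia_nextK sc.
  by move: ic; rewrite prevE (negbTE (out false)).
- by rewrite outer_after ?sc.
Qed.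

Lemma top_colors :
  [/\ color_after g (q, true) = color_after g (p, true),
      color_after f (m3_iso m p, true) = color_after g (p, true)
    & color_after f (m3_iso m q, true) = color_after g (p, true)].
Proof.
have [sp sq _ _ _] := triangle_swapE.
have : inner (if m3_et m then p else q, true) by rewrite /move3_inner /= eqxx.
case: m3_et => /inner_strand; rewrite ?sp ?sq /image_passage /= !before_over.
  by case=> E1 E2 E3 E4; split; congruence.
by case=> E1 E2 E3 E4; split; congruence.
Qed.

(** The middle strand passes under the top one with the same colors on both sides
of the move, but its over-arc at r is the one beyond p on one side of the move
and the one short of p on the other. *)
Lemma middle_colors :
  [/\ color_before f (m3_iso m p, false) = color_before g (p, false),
      color_after f (m3_iso m p, false) = color_after g (p, false),
      color_after g (r, true)
        = (if m3_em m then color_after g (p, false) else color_before g (p, false))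
    & color_after f (m3_iso m r, true)
        = (if m3_em m then color_before g (p, false) else color_after g (p, false))].
Proof.
have [_ _ sp' sr _] := triangle_swapE.
have : inner (if m3_em m then (p, false) else (r, true)).
  by rewrite /move3_inner /= eqxx orbT.
case: m3_em => /inner_strand; rewrite ?sp' ?sr /image_passage /= !before_over.
  by case=> E1 E2 E3 E4; split; congruence.
by case=> E1 E2 E3 E4; split; congruence.
Qed.

Lemma top_middle_weight : weight f i (m3_iso m p) = weight g i p.
Proof.
have [_ topE _] := top_colors; have [inE outE _ _] := middle_colors.
apply: eq_weight => [|b||[]] //; first exact: m3_pos.
exact: (m3_comp m (p, b)).
Qed.

(** The successive colors of the bottom strand, followed in E from q to r whatever
its orientation: the end next to q, the part between q and r, the end next to r.
In D, where r is met first, the ends have the same colors and the part in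
between has the color bottom_mid'. *)
Definition bottom_end_q :=
  if m3_eb m then color_before g (q, false) else color_after g (q, false).
Definition bottom_mid :=
  if m3_eb m then color_after g (q, false) else color_before g (q, false).
Definition bottom_end_r :=
  if m3_eb m then color_after g (r, false) else color_before g (r, false).
Definition bottom_mid' :=
  if m3_eb m then color_before f (m3_iso m q, false)
  else color_after f (m3_iso m q, false).

Lemma bottom_colors :
  [/\ (if m3_eb m then color_before g (r, false) else color_after g (r, false)) = bottom_mid,
      (if m3_eb m then color_after f (m3_iso m q, false)
       else color_before f (m3_iso m q, false)) = bottom_end_r,
      (if m3_eb m then color_before f (m3_iso m r, false)
       else color_after f (m3_iso m r, false)) = bottom_end_q
    & (if m3_eb m then color_after f (m3_iso m r, false)
       else color_before f (m3_iso m r, false)) = bottom_mid'].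
Proof.
have [_ _ _ _ [sq' sr']] := triangle_swapE.
have : inner (if m3_eb m then q else r, false).
  by rewrite /move3_inner /= eqxx !orbT.
rewrite /bottom_mid /bottom_end_r /bottom_end_q /bottom_mid'.
case: m3_eb => /inner_strand; rewrite ?sq' ?sr' /image_passage /=.
  by case.
by case.
Qed.

Lemma image_comp c b : dia_comp (m3_iso m c, b) = dia_comp (c, b).
Proof. exact: (m3_comp m (c, b)). Qed.

Lemma bottom_comp : dia_comp (q, false) = dia_comp (r, false).
Proof.
by have := m3_bottom m; rewrite /consecutive; case: m3_eb => <-;
  rewrite dia_comp_next.
Qed.

Lemma middle_comp : dia_comp (p, false) = dia_comp (r, true).
Proof.
by have := m3_middle m; rewrite /consecutive; case: m3_em => <-;
  rewrite dia_comp_next.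
Qed.

Lemma top_comp : dia_comp (p, true) = dia_comp (q, true).
Proof.
by have := m3_top m; rewrite /consecutive; case: m3_et => <-;
  rewrite dia_comp_next.
Qed.

Lemma bottom_weights_homologous :
  homologous (weight g i q + weight g i r)
             (weight f i (m3_iso m q) + weight f i (m3_iso m r)).
Proof.
have [over_q _ over_q'] := top_colors.
have [in_p out_p over_r over_r'] := middle_colors.
have [E1 E2 E3 E4] := bottom_colors.
have gp : good R p := m3_permitted_middle m.
have gq : good R q := m3_permitted_bottom m.
have goodE c : good R (m3_iso m c) = good R c by rewrite /good !image_comp.
(* Whether r lies in E on the target side of the top strand, and q on the
   source side of the middle strand. *)
pose tau := m3_eb m == dia_pos q; pose mu := m3_eb m == dia_pos r.
(* The triangle condition: r is on the same side of the top strand when it is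
   reached along the middle strand. *)
have tauE : tau = (m3_em m == dia_pos p).
  rewrite /tau; have [+ _] := m3_triangle m.
  by case: m3_et; case: m3_em; case: m3_eb; do 2!case: dia_pos.
have source_q : g (under_source q) = if tau then bottom_end_q else bottom_mid.
  rewrite under_sourceE /tau /bottom_end_q /bottom_mid.
  by case: m3_eb; case: dia_pos.
have target_q : g (under_target q) = if tau then bottom_mid else bottom_end_q.
  rewrite under_targetE /tau /bottom_end_q /bottom_mid.
  by case: m3_eb; case: dia_pos.
have source_r : g (under_source r) = if mu then bottom_mid else bottom_end_r.
  rewrite under_sourceE /mu -E1 /bottom_end_r.
  by case: m3_eb; case: dia_pos.
have target_r : g (under_target r) = if mu then bottom_end_r else bottom_mid.
  rewrite under_targetE /mu -E1 /bottom_end_r.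
  by case: m3_eb; case: dia_pos.
have source_q' : f (under_source (m3_iso m q)) =
    if tau then bottom_mid' else bottom_end_r.
  rewrite under_sourceE m3_pos /tau /bottom_mid' -E2.
  by case: m3_eb; case: dia_pos.
have target_q' : f (under_target (m3_iso m q)) =
    if tau then bottom_end_r else bottom_mid'.
  rewrite under_targetE m3_pos /tau /bottom_mid' -E2.
  by case: m3_eb; case: dia_pos.
have source_r' : f (under_source (m3_iso m r)) =
    if mu then bottom_end_q else bottom_mid'.
  rewrite under_sourceE m3_pos /mu -E3 -E4.
  by case: m3_eb; case: dia_pos.
have target_r' : f (under_target (m3_iso m r)) =
    if mu then bottom_mid' else bottom_end_q.
  rewrite under_targetE m3_pos /mu -E3 -E4.
  by case: m3_eb; case: dia_pos.
have pos_q : dia_pos q = (m3_eb m == tau).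
  by rewrite /tau; case: m3_eb; case: dia_pos.
have pos_r : dia_pos r = (m3_eb m == mu).
  by rewrite /mu; case: m3_eb; case: dia_pos.
have rule_q := color_rule g gq; rewrite over_q source_q target_q in rule_q.
have gq' : good R (m3_iso m q) by rewrite goodE.
have rule_q' := color_rule f gq'.
rewrite over_q' source_q' target_q' in rule_q'.
rewrite /weight !goodE !image_comp gq bottom_comp.
case: (dia_comp (r, false) == i); last first.
  by rewrite !andbF; apply: homologous_refl.
rewrite !andbT !m3_pos over_q over_q' source_q source_q' source_r source_r'.
have [gr|br] := boolP (good R r); last first.
  (* The bottom strand does not change color at r, on either side. *)
  have mid_r : bottom_mid = bottom_end_r.
    rewrite -E1 /bottom_end_r; have := under_after_bad g br.
    by case: m3_eb.
  have mid_r' : bottom_mid' = bottom_end_q.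
    have br' : ~~ good R (m3_iso m r) by rewrite goodE.
    by rewrite -E3 -E4; have := under_after_bad f br'; case: m3_eb.
  by rewrite mid_r mid_r'; apply: homologous_refl.
have rule_p := color_rule g gp.
set a := g (under_source p) in rule_p.
set t := color_after g (p, true) in rule_p *.
have over_rE : color_after g (r, true) = if tau then star a t else a.
  rewrite over_r rule_p /a tauE under_sourceE under_targetE.
  by case: m3_em; case: dia_pos.
have over_r'E : color_after f (m3_iso m r, true) = if tau then a else star a t.
  rewrite over_r' rule_p /a tauE under_sourceE under_targetE.
  by case: m3_em; case: dia_pos.
have gr' : good R (m3_iso m r) by rewrite goodE.
have rule_r := color_rule g gr; rewrite over_rE source_r target_r in rule_r.
have rule_r' := color_rule f gr'.
rewrite over_r'E source_r' target_r' in rule_r'.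
rewrite over_rE over_r'E pos_q pos_r.
apply: bottom_strand_homologous => //.
- exact: source_rel.
- have Rqp : R (dia_comp (q, false)) (dia_comp (p, true)) by rewrite top_comp.
  have Rrp : R (dia_comp (r, false)) (dia_comp (p, true)) by rewrite -bottom_comp.
  have [_ bq_t _ aq_t] := passage_rel g Rqp.
  have [_ br_t _ ar_t] := passage_rel g Rrp.
  have [_ bq_t' _ aq_t'] := passage_rel f gq'; rewrite over_q' -/t in bq_t' aq_t'.
  by rewrite /bottom_end_q /bottom_mid /bottom_end_r /bottom_mid'; case: m3_eb.
have Rqp : R (dia_comp (q, false)) (dia_comp (p, false)).
  by rewrite bottom_comp middle_comp.
have Rrp : R (dia_comp (r, false)) (dia_comp (p, false)) by rewrite middle_comp.
have Rqp' : R (dia_comp (m3_iso m q, false)) (dia_comp (m3_iso m p, false)).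
  by rewrite !image_comp.
have := (passage_rel g Rqp, passage_rel g Rrp, passage_rel f Rqp').
rewrite in_p out_p /a under_sourceE.
rewrite /bottom_end_q /bottom_mid /bottom_end_r /bottom_mid'.
by case: m3_eb; case: dia_pos; case=> -[[]] => ? ? ? ? [] ? ? ? ? [] ? ? ? ?.
Qed.

End Triangle.

Lemma move3_homologous (m : move3 R E D) :
  agree_outside (MoveIII m) g f -> homologous (z_chain g i) (z_chain f i).
Proof.
move=> agree; rewrite !z_chainE.
rewrite [in X in homologous _ X](reindex (m3_iso m)) /=; last first.
  exact/onW_bij/m3_bij.
have := m3_uniq m; rewrite /= !inE negb_or => /and3P[/andP[pq pr] qr _].
have split3 (F : crossing E -> CPR X 2) : \sum_c F c =
    F (m3_p m) + (F (m3_q m) + F (m3_r m)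
    + \sum_(c | c \notin [:: m3_p m; m3_q m; m3_r m]) F c).
  rewrite (bigD1 (m3_p m)) //= (bigD1 (m3_q m)) /=; last by rewrite eq_sym.
  rewrite (bigD1 (m3_r m)) /=; last by rewrite ![m3_r m == _]eq_sym pr qr.
  rewrite addrA; congr (_ + (_ + _)); apply: eq_bigl => c.
  by rewrite !inE !negb_or andbA.
rewrite !split3; apply: homologousD.
  by rewrite (top_middle_weight agree); apply: homologous_refl.
apply: homologousD; first exact: bottom_weights_homologous.
rewrite [X in homologous _ X](eq_bigr (weight g i)); first exact: homologous_refl.
by move=> c; apply: outside_weight.
Qed.

Lemma agree_homologous (m : reidemeister R E D) :
  agree_outside m g f -> homologous (z_chain g i) (z_chain f i).
Proof.
case: m => m; [exact: move1_homologous|exact: move2_homologous|].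
exact: move3_homologous.
Qed.

End Moves.
End Crossings.

Theorem theorem3p18 (X : partialQuandle) (s : nat) (R : rel 'I_s)
    (D : linkDiagram s) (f : coloringII D X R) :
  (forall i : 'I_s, bdQ (z_class f i) = 0) /\
  (forall (D' : linkDiagram s) (f' : coloringII D' X R),
     reidemeister_related f f' ->
     forall (i : 'I_s)
       (hz : bdQ (z_class f i) = 0) (hz' : bdQ (z_class f' i) = 0),
       classH hz = classH hz').
Proof.
split=> [i|D' f' rel i hz hz']; first exact: z_class_cycle.
apply: homologous_classH; case: rel => [[m agree]|[m agree]].
  exact: agree_homologous agree.
exact/homologous_sym/(agree_homologous i agree).
Qed.
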